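(* Let $R$ be a finite commutative ring with identity $1\ne 0$. Suppose that every primary component of $R$ is a local ring. Then each quasiprimitive S-ring $\mathcal A$ over the ring $R$ is either of rank $2$ or cyclotomic. In the latter case $R$ is a field.
   Context: S-rings. Let $G$ be a finite group. For $X\subseteq G$ put $\xi(X)=\sum_{x\in X}x\in\mathbb Z[G]$. A subring $\mathcal A$ of the group ring $\mathbb Z[G]$ is an S-ring (Schur ring) over $G$ if it has a $\mathbb Z$-basis $\{\xi(X): X\in\mathcal S\}$, where $\mathcal S=\mathcal S(\mathcal A)$ is a family of pairwise disjoint nonempty subsets of $G$ with $\{1\}\in\mathcal S$ (here $1$ is the identity element of $G$), $\bigcup_{X\in\mathcal S}X=G$, and $X\in\mathcal S\Rightarrow X^{-1}\in\mathcal S$. The elements of $\mathcal S$ are the basic sets of $\mathcal A$. The rank of $\mathcal A$ is $\mathrm{rk}(\mathcal A)=\dim_{\mathbb Z}(\mathcal A)=|\mathcal S|$. A subgroup of $G$ is an $\mathcal A$-subgroup if it is a union of basic sets. For $K\le\mathrm{Aut}(G)$, the S-ring $\mathcal A$ is $K$-invariant if $\mathcal A^k=\mathcal A$ for every $k\in K$, where $\mathrm{Aut}(G)$ acts on $\mathbb Z[G]$ by linear extension (equivalently, each $k\in K$ permutes the basic sets; the individual basic sets need not be fixed). $\mathcal A$ is $K$-primitive if the identity subgroup and $G$ are the only $K$-invariant $\mathcal A$-subgroups of $G$. S-rings over rings. Let $R$ be a finite commutative ring with identity, with additive group $R^+$ and unit group $R^\times$. Let $K_R\le\mathrm{Aut}(R^+)$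 be the group of all maps $x\mapsto ux$, $u\in R^\times$. An S-ring over the ring $R$ is a $K_R$-invariant S-ring over the group $R^+$. It is quasiprimitive if it is $K_R$-primitive. It is cyclotomic if for some subgroup $K\le K_R$ it consists of all $K$-invariant (fixed by every element of $K$) elements of $\mathbb Z[R^+]$; equivalently, its basic sets are exactly the orbits of $K$ on $R$. Primary components. $R=\prod_p R_p$, where $p$ runs over the prime divisors of $|R|$ and the primary component $R_p$ is the subring of $R$ (a ring with its own identity) whose additive group is the Sylow $p$-subgroup of $R^+$. A ring is local if its non-units form an ideal. *)

(* Defs.v *)
From HB Require Import structures.
From mathcomp Require Import all_boot all_algebra all_fingroup all_solvable.

Set Implicit Arguments.
Unset Strict Implicit.
Unset Printing Implicit Defensive.

Import GRing.Theory.
Local Open Scope ring_scope.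

(* The integral group ring Z[G] of a finite group G, with the convolution
   product.  The alias keeps the pointwise product of {ffun _} away. *)
Definition gring (gT : finGroupType) : Type := {ffun gT -> int}.

HB.instance Definition _ (gT : finGroupType) :=
  GRing.Zmodule.copy (gring gT) {ffun gT -> int}.

Section GroupRing.

Variable gT : finGroupType.
Implicit Types (a b c : gring gT) (x y z : gT) (X : {set gT}).

(* The element xi(X), the sum in Z[G] of the elements of X. *)
Definition gsum X : gring gT := [ffun x => (x \in X)%:R].

Definition gring_one : gring gT := gsum [set 1%g].

Definition gring_mul a b : gring gT :=
  [ffun z => \sum_(x : gT) a x * b (x^-1 * z)%g].

Lemma gring_mulA : associative gring_mul.
Proof.
move=> a b c; apply/ffunP=> z; rewrite !ffunE.
under eq_bigr do rewrite ffunE mulr_sumr.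
under [RHS]eq_bigr do rewrite ffunE mulr_suml.
rewrite [RHS]exchange_big; apply: eq_bigr => x _ /=.
rewrite [RHS](reindex_inj (mulgI x)) /=; apply: eq_bigr => y _.
by rewrite mulKg invMg !mulgA mulrA.
Qed.

Lemma gring_mul1 : left_id gring_one gring_mul.
Proof.
move=> a; apply/ffunP=> z; rewrite ffunE (bigD1 1%g) //= big1 => [|x x1].
  by rewrite !ffunE set11 mul1r invg1 mul1g addr0.
by rewrite !ffunE inE (negPf x1) mul0r.
Qed.

Lemma gring_mulr1 : right_id gring_one gring_mul.
Proof.
move=> a; apply/ffunP=> z; rewrite ffunE (bigD1 z) //= big1 => [|x xz].
  by rewrite !ffunE mulVg set11 mulr1 addr0.
by rewrite !ffunE inE -eq_mulVg1 (negPf xz) mulr0.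
Qed.

Lemma gring_mulDl : left_distributive gring_mul +%R.
Proof.
move=> a b c; apply/ffunP=> z; rewrite !ffunE -big_split /=.
by apply: eq_bigr => x _; rewrite ffunE mulrDl.
Qed.

Lemma gring_mulDr : right_distributive gring_mul +%R.
Proof.
move=> a b c; apply/ffunP=> z; rewrite !ffunE -big_split /=.
by apply: eq_bigr => x _; rewrite ffunE mulrDr.
Qed.

Lemma gring_one_neq0 : gring_one != 0.
Proof. by apply/eqP=> /ffunP/(_ 1%g); rewrite !ffunE set11. Qed.

End GroupRing.

HB.instance Definition _ (gT : finGroupType) :=
  GRing.Zmodule_isNzRing.Build (gring gT)
    (@gring_mulA gT) (@gring_mul1 gT) (@gring_mulr1 gT)
    (@gring_mulDl gT) (@gring_mulDr gT) (gring_one_neq0 gT).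

Section SRings.

Variable gT : finGroupType.
Implicit Types (a b : gring gT) (k : {perm gT}) (K : {set {perm gT}}).
Implicit Types (S : {set {set gT}}) (H : {group gT}).

(* The family of the xi(X), X in S, is a Z-basis of A. *)
Definition is_Zbasis S (A : {pred gring gT}) : Prop :=
  [/\ {in S, forall X, gsum X \in A},
      forall c : {set gT} -> int,
        \sum_(X in S) gsum X *~ c X = 0 -> {in S, forall X, c X = 0}
    & {in A, forall a,
        exists c : {set gT} -> int, a = \sum_(X in S) gsum X *~ c X}].

(* An S-ring is determined by its elements: the basic sets are recorded as a
   component but there is only one possible choice for them.  Membership is
   boolean without loss of generality, as being an integral combination of the
   xi(X) amounts to being constant on each X in S. *)
Record sring := SRing {
  sring_elems :> {pred gring gT};
  basic_sets : {set {set gT}};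
  sring_subring : subring_closed sring_elems;
  sring_partition : partition basic_sets [set: gT];
  sring_set1 : [set 1%g] \in basic_sets;
  sring_inv : {in basic_sets, forall X, (X^-1)%g \in basic_sets};
  sring_basis : is_Zbasis basic_sets sring_elems
}.

Definition sring_rank (A : sring) : nat := #|basic_sets A|.

Definition sring_subgroup (A : sring) H : Prop :=
  exists2 P : {set {set gT}}, P \subset basic_sets A & H = cover P :> {set gT}.

(* The linear extension to Z[G] of a permutation of G. *)
Definition gring_act k a : gring gT := \sum_(x : gT) gsum [set k x] *~ a x.

(* The following two notions are meant for K \subset Aut [set: gT]. *)
Definition sring_invariant K (A : sring) : Prop :=
  {in K, forall k b, b \in A <-> (exists2 a, a \in A & b = gring_act k a)}.

Definition sring_primitive K (A : sring) : Prop :=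
  forall H, sring_subgroup A H -> {in K, forall k, k @: H = H} ->
  H = 1%G \/ H = [set: gT]%G.

End SRings.

(* A finComUnitRingType R is nontrivial, and as a finGroupType it denotes its
   additive group.  The action 'U of {unit R} on R is by
   multiplication, so unit_perms is the group of all maps x |-> u * x. *)
Section OverRing.

Variable R : finComUnitRingType.
Implicit Types (P I : {set R}) (A : sring R).

Definition unit_perms : {group {perm R}} :=
  (actperm 'U @* [set: {unit R}])%G.

Lemma unit_permsP (k : {perm R}) :
  reflect (exists2 u : R, u \is a GRing.unit & forall x, k x = u * x)
          (k \in unit_perms).
Proof.
apply: (iffP morphimP) => [[u _ _ ->]|[u Uu kE]].
  by exists (val u); rewrite ?(valP u) // => x; rewrite actpermE /= mulrC.
exists (FinRing.unit R Uu); rewrite ?inE //.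
by apply/permP=> x; rewrite actpermE /= kE mulrC.
Qed.

Lemma unit_perms_Aut : unit_perms \subset Aut [set: R].
Proof.
apply/subsetP=> k /unit_permsP[u _ kE]; rewrite inE; apply/andP; split.
  by apply/subsetP=> x _; rewrite inE.
by apply/morphicP=> x y _ _; rewrite !kE; exact: mulrDr.
Qed.

Definition sring_over_ring A : Prop := sring_invariant unit_perms A.

Definition quasiprimitive A : Prop := sring_primitive unit_perms A.

Definition cyclotomic A : Prop :=
  exists2 K : {group {perm R}}, K \subset unit_perms
    & forall a : gring R,
        a \in A <-> {in K, forall k, gring_act k a = a}.

(* A primary component does not contain 1 in general: units are taken
   relative to its own identity e. *)
Definition nonunits P (e : R) : {set R} :=
  [set x in P | ~~ [exists y in P, x * y == e]].

Definition ideal_of P I : Prop :=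
  [/\ I \subset P, 0 \in I, {in I &, forall x y, x + y \in I}
    & {in P & I, forall x y, x * y \in I}].

Definition local_subring P : Prop :=
  exists e : R,
    [/\ e \in P, {in P, forall x, e * x = x} & ideal_of P (nonunits P e)].

Definition primary_component (p : nat) (P : {group R}) : Prop :=
  [/\ prime p, (p %| #|R|)%N & (p.-Sylow([set: R]) P)%g].

End OverRing.

(* Main.v *)
Require Import Defs.
From mathcomp Require Import all_boot all_algebra all_fingroup all_solvable.
From mathcomp Require Import algC algnum classfun character integral_char.
From mathcomp Require Import ring zify.

Set Implicit Arguments.
Unset Strict Implicit.
Unset Printing Implicit Defensive.

Import GRing.Theory Num.Theory.
Local Open Scope ring_scope.

(* The basic sets of A give a map c sending x to its class, and an S-ring is
   handled through c alone.

   Local R, with set M of nonunits.  If M = 0, R is a field and the basic sets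
   are the cosets of the multiplicative group {u | c u = c 1}.  Otherwise every
   nonzero class contains a unit, so the units permute the r nonzero classes
   transitively; hence r divides #|M| - 1 and is prime to #|1 + M|, so 1 + M
   fixes every class, the nonzero classes are unions of M-cosets outside M, and
   a count of differences shows that there is only one.

   Otherwise let p divide #|R|, q = p ^ k the order of the primary component
   e R, M the maximal ideal of nonunits in the e-component, and fuse the classes
   under the units.  For characters chi0 trivial on e R and eta trivial on M,
   the values of chi0 and chi1 = chi0 * eta on any sum of a fused class are
   congruent modulo q.  They are in fact equal: if not, take the sum F of the
   conjugates of the characters agreeing with chi0 on all classes.  It is
   constant on classes, F(x)^q = F(q x) mod p, and x |-> F(q x) is constant mod
   p by primitivity, so b := F - F(0) is nilpotent mod p.  Since b has Fourier
   coefficients #|R| at chi0 and 0 at chi1, the congruence modulo q, applied to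
   b and divided by q, makes #|R| / q nilpotent mod p, although it is prime to
   p.  Fourier inversion then shows that all elements outside M are in one fused
   class, which by primitivity contains every nonzero element. *)

(** * Class maps: saturated sets, convolution counts and periods *)

Section ClassMaps.

Variables (R : finComUnitRingType) (T : finType) (c : R -> T).
Implicit Types (x y z u v : R) (N M Y Z : {set R}).

(* For c x the basic set of x, the last condition says that products of basic
   sums are constant on the basic sets. *)
Definition class_map : Prop :=
  [/\ forall x, c x = c 0 -> x = 0,
      forall u x y, u \is a GRing.unit -> c x = c y -> c (u * x) = c (u * y)
    & forall s t z z', c z = c z' ->
        #|[set x | (c x == s) && (c (z - x) == t)]| =
        #|[set x | (c x == s) && (c (z' - x) == t)]| ].

Definition saturated Y : Prop := forall x y, c x = c y -> x \in Y -> y \in Y.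

Definition unit_stable Y : Prop :=
  forall u x, u \is a GRing.unit -> x \in Y -> u * x \in Y.

Definition add_closed Y : Prop := forall x y, x \in Y -> y \in Y -> x + y \in Y.

(** Such an N is closed under negation as well, since -1 is a unit; so N is a subgroup. *)
Definition class_primitive : Prop :=
  forall N, 0 \in N -> add_closed N -> unit_stable N -> saturated N ->
  N = [set 0] \/ N = setT.

Hypothesis cP : class_map.

Lemma class_eq0 x : c x = c 0 -> x = 0. Proof. by case: cP => /(_ x). Qed.

Lemma class_unit u x y : u \is a GRing.unit -> c x = c y -> c (u * x) = c (u * y).
Proof. by case: cP => _ /(_ u x y). Qed.

(** Grouping the x by the pair of classes of x and z - x turns the sum into a combination of the
    counts in [class_map]. *)
Lemma class_convolution (V : pzSemiRingType) (f g : T -> V) z z' : c z = c z' ->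
  \sum_x f (c x) * g (c (z - x)) = \sum_x f (c x) * g (c (z' - x)).
Proof.
move=> czz'; have E w : \sum_x f (c x) * g (c (w - x)) =
    \sum_(st : T * T) (f st.1 * g st.2) *+
       #|[set x | (c x == st.1) && (c (w - x) == st.2)]|.
  rewrite (partition_big (fun x => (c x, c (w - x))) predT) //=.
  apply: eq_bigr => -[s t] _ /=; rewrite -sumr_const.
  apply: eq_big => [x|x]; first by rewrite inE xpair_eqE.
  by move=> /eqP[-> ->].
rewrite !E; apply: eq_bigr => -[s t] _ /=; congr (_ *+ _).
by case: cP => _ _ /(_ s t _ _ czz').
Qed.

Lemma saturated_indicator Y : saturated Y ->
  exists f : T -> nat, forall x, f (c x) = (x \in Y).
Proof.
move=> satY; exists (fun s => [exists x in Y, c x == s]) => x; congr nat_of_bool.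
apply/existsP/idP => [[y /andP[Yy /eqP cyx]]|Yx]; first exact: satY cyx Yy.
by exists x; rewrite Yx eqxx.
Qed.

Lemma saturated_count Y Z z z' : saturated Y -> saturated Z -> c z = c z' ->
  #|[set x in Y | z - x \in Z]| = #|[set x in Y | z' - x \in Z]|.
Proof.
move=> /saturated_indicator[f fE] /saturated_indicator[g gE] czz'.
have E w : #|[set x in Y | w - x \in Z]| = \sum_x f (c x) * g (c (w - x)).
  rewrite -sum1_card (eq_bigl (fun x => (x \in Y) && (w - x \in Z))) => [|x].
    by rewrite big_mkcond; apply: eq_bigr => x _; rewrite fE gE; do 2!case: (_ \in _).
  by rewrite inE.
by rewrite !E; exact: (class_convolution (V := nat) f g czz').
Qed.

Lemma saturated_opp Y : saturated Y -> saturated [set x | - x \in Y].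
Proof.
move=> satY x y cxy; rewrite !inE; apply: satY.
by rewrite -(mulN1r x) -(mulN1r y); apply: class_unit => //; rewrite unitrN unitr1.
Qed.

Lemma translate_count Y x y : saturated Y -> c x = c y ->
  #|[set z in Y | z - x \in Y]| = #|[set z in Y | z - y \in Y]|.
Proof.
move=> satY cxy; have := saturated_count satY (saturated_opp satY) cxy.
by congr (_ = _); apply: eq_card => z; rewrite !inE opprB.
Qed.

Hypothesis prim : class_primitive.

(* The union of the classes contained in a subgroup M is again a subgroup,
   because the sum of two classes is a union of classes. *)
Lemma class_meets_complement M x :
  0 \in M -> add_closed M -> unit_stable M -> 1 \notin M -> x != 0 ->
  exists2 y, c y = c x & y \notin M.
Proof.
move=> M0 addM unM M1 x0.
pose N := [set z | [forall y, (c y == c z) ==> (y \in M)]].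
have NE z : (z \in N) = [forall y, (c y == c z) ==> (y \in M)] by rewrite inE.
clearbody N; have NP z : reflect (forall y, c y = c z -> y \in M) (z \in N).
  rewrite NE; apply: (iffP forallP) => [h y /eqP e|h y].
    by move/implyP: (h y); apply.
  by apply/implyP => /eqP; exact: h.
have satN : saturated N.
  by move=> y z cyz /NP h; apply/NP => w cw; apply: h; rewrite cw.
case: (@prim N) => [||||N1|NT].
- by apply/NP => y /class_eq0->.
- move=> y z Ny Nz; apply/NP => w cw.
  have := saturated_count satN satN cw.
  have /card_gt0P[v] : (0 < #|[set v in N | (w - v)%R \in N]|)%N.
    rewrite (saturated_count satN satN cw); apply/card_gt0P; exists y.
    by rewrite inE Ny addrAC subrr add0r.
  rewrite inE => /andP[Nv Nwv] _; rewrite -(subrK v w).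
  by apply: addM; [move/NP: Nwv | move/NP: Nv]; apply.
- move=> u z Uu /NP h; apply/NP => y cy; rewrite -(mulVKr Uu y).
  apply: unM => //; apply: h; rewrite -(mulKr Uu z).
  by apply: class_unit; rewrite ?unitrV.
- exact: satN.
- have : x \notin N by rewrite N1 inE.
  rewrite NE negb_forall => /existsP[y]; rewrite negb_imply => /andP[/eqP cy My].
  by exists y.
- case/negP: M1; have /NP : 1 \in N by rewrite NT inE.
  exact.
Qed.

(** The elements all of whose unit multiples are periods of Y form a subgroup. It is saturated: by
    [translate_count], the number of z in Y with z - k in Y depends only on the class of k, and it
    is #|Y| exactly for periods. The subgroup contains h, so by primitivity it is R. *)
Lemma saturated_periodic Y h : saturated Y -> h != 0 ->
  (forall u x, u \is a GRing.unit -> x \in Y -> x + u * h \in Y) ->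
  Y = set0 \/ Y = setT.
Proof.
move=> satY h0 per.
pose N := [set k | [forall u, (u \is a GRing.unit) ==>
                     [forall x in Y, x - u * k \in Y]]].
have NP k : reflect (forall u x, u \is a GRing.unit -> x \in Y -> x - u * k \in Y)
                    (k \in N).
  rewrite inE; apply: (iffP forallP) => [H u x Uu Yx|H u].
    by move/implyP/(_ Uu)/forallP/(_ x)/implyP: (H u); apply.
  by apply/implyP => Uu; apply/forallP => x; apply/implyP; exact: H.
case: (@prim N) => [||||N1|NT].
- by apply/NP => u x _; rewrite mulr0 subr0.
- move=> k l /NP Nk /NP Nl; apply/NP => u x Uu Yx.
  by rewrite mulrDr opprD addrA Nl ?Nk.
- move=> v k Uv /NP Nk; apply/NP => u x Uu; rewrite mulrA; apply: Nk.
  by rewrite unitrM Uu.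
- move=> k l ckl /NP Nk; apply/NP => u x Uu Yx.
  have E : [set z in Y | z - u * l \in Y] = Y.
    apply/eqP; rewrite eqEcard; apply/andP; split.
      by apply/subsetP => z; rewrite inE => /andP[].
    rewrite -(translate_count satY (class_unit Uu ckl)) subset_leq_card //.
    by apply/subsetP => z Yz; rewrite inE Yz Nk.
  by move: Yx; rewrite -{1}E inE => /andP[].
- have : h \in N.
    apply/NP => u x Uu Yx; rewrite -mulNr; apply: per => //.
    by rewrite unitrN.
  by rewrite N1 inE (negPf h0).
- have [->|[y Yy]] := set_0Vmem Y; [by left | right].
  apply/setP => x; rewrite inE.
  have /NP/(_ 1 y) : y - x \in N by rewrite NT inE.
  by rewrite unitr1 Yy mul1r opprB addrC subrK => ->.
Qed.

End ClassMaps.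

(** * Local rings: classes under translation by the maximal ideal *)

Section LocalRing.

Variables (R : finComUnitRingType) (T : finType) (c : R -> T).
Hypotheses (cP : class_map c) (prim : class_primitive c).

Let M : {set R} := [set x | x \isn't a GRing.unit].
Hypothesis addM : add_closed M.

Let inM x : (x \in M) = (x \isn't a GRing.unit). Proof. exact: in_set. Qed.

Let M0 : 0 \in M. Proof. by rewrite inM unitr0. Qed.

Let M1 : 1 \notin M. Proof. by rewrite inM unitr1. Qed.

Let mulM x y : x \in M -> y * x \in M.
Proof. by rewrite !inM unitrM negb_and orbC => ->. Qed.

Let unitM : unit_stable M. Proof. by move=> u x _; exact: mulM. Qed.

Lemma class_meets_units x : x != 0 -> exists2 u, u \is a GRing.unit & c u = c x.
Proof.
move=> x0; have [y cy My] := class_meets_complement cP prim M0 addM unitM M1 x0.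
by exists y; rewrite // -[_ \is a _]negbK -inM.
Qed.

Let unit_one_plus m : m \in M -> 1 + m \is a GRing.unit.
Proof.
move=> Mm; apply: contraR M1; rewrite -inM => M1m.
have -> : 1 = (1 + m) + (-1) * m by ring.
by apply: addM => //; exact: mulM.
Qed.

Let K : {set {unit R}} := [set u | c (val u) == c 1].

Let KP (u : {unit R}) : (u \in K) = (c (val u) == c 1). Proof. exact: in_set. Qed.

Let group_K : group_set K.
Proof.
apply/group_setP; split=> [|u v]; rewrite !KP ?eqxx // => /eqP cu /eqP cv.
by rewrite FinRing.val_unitM (class_unit cP (valP u) cv) mulr1 cu.
Qed.
Canonical stab_group := Group group_K.

Let V : {set {unit R}} := [set u | val u - 1 \in M].

Let VP (u : {unit R}) : (u \in V) = (val u - 1 \in M). Proof. exact: in_set. Qed.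

Let group_V : group_set V.
Proof.
apply/group_setP; split=> [|u v]; rewrite !VP ?subrr // => Mu Mv.
rewrite FinRing.val_unitM.
have -> : val u * val v - 1 = val u * (val v - 1) + (val u - 1) by ring.
by apply: addM => //; exact: mulM.
Qed.
Canonical one_plus_group := Group group_V.

Let card_V : #|V| = #|M|.
Proof.
have inj : injective (fun u : {unit R} => val u - 1).
  by move=> u v /addIr /val_inj.
rewrite -(card_imset _ inj); apply: eq_card => x.
apply/imsetP/idP => [[u]|Mx]; first by rewrite VP => Mu ->.
have U1x : x + 1 \is a GRing.unit by rewrite addrC unit_one_plus.
by exists (FinRing.unit R U1x); rewrite ?VP /= addrK.
Qed.

Let class_card (u : {unit R}) : #|[set v : {unit R} | c (val v) == c (val u)]| = #|K|.
Proof.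
rewrite -(card_imset _ (mulgI u^-1%g)); apply: eq_card => v.
have cU (w z : {unit R}) : (c (val (w * z)%g) == c (val w)) = (z \in K).
  rewrite KP FinRing.val_unitM; apply/eqP/eqP => [E|E].
    have := class_unit cP (u := (val w)^-1) _ E.
    by rewrite unitrV mulKr ?(valP w) ?mulVr ?(valP w) //; apply.
  by rewrite (class_unit cP (valP w) E) mulr1.
apply/imsetP/idP => [[w]|Kv].
  by rewrite inE -[in X in X -> _](mulKVg u w) cU => Kv ->.
by exists (u * v)%g; rewrite ?mulKg // inE cU.
Qed.

(** The pairs (x, u) with x nonzero in M, u a unit and c u = c x are counted in two ways. Each x
    belongs to #|K| pairs, as its class contains a unit; each u belongs to m pairs, as
    multiplication by u carries the class of 1 to that of u. *)
Let index_dvd : (#|[set: {unit R}] : K|%g %| #|M :\ 0%R|)%N.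
Proof.
pose m := #|[set x in M :\ 0 | c x == c 1]|.
have E (u : {unit R}) : #|[set x in M :\ 0 | c x == c (val u)]| = m.
  have inj : injective ( *%R (val u)) by apply: mulrI; exact: valP.
  rewrite /m -[in RHS](card_imset _ inj); apply: eq_card => x.
  apply/idP/imsetP => [|[y]].
    rewrite !inE -andbA => /and3P[x0 Ux /eqP cx].
    exists ((val u)^-1 * x); last by rewrite mulVKr ?(valP u).
    rewrite !inE mulrI_eq0 ?x0; last by apply: mulrI; rewrite unitrV (valP u).
    rewrite unitrM unitrV (valP u) /= Ux /=.
    have := class_unit cP (u := (val u)^-1) _ cx.
    by rewrite unitrV (valP u) mulVr ?(valP u) // => ->.
  rewrite !inE -andbA => /and3P[y0 Uy /eqP cy] ->.
  rewrite mulrI_eq0 ?y0 //; rewrite unitrM (valP u) /= Uy /=.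
  by rewrite (class_unit cP (valP u) cy) mulr1.
have D : (#|M :\ 0%R| * #|K| = #|[set: {unit R}]| * m)%N.
  rewrite -!sum_nat_const.
  transitivity (\sum_(x in M :\ 0%R) \sum_(u : {unit R} | c (val u) == c x) 1)%N.
    apply: eq_bigr => x; rewrite !inE => /andP[/class_meets_units[y Uy cy] _].
    rewrite -(class_card (FinRing.unit R Uy)) sum1dep_card /= cy.
    by apply: eq_card => v; rewrite inE.
  rewrite (exchange_big_dep predT) //= [RHS](eq_bigl predT) => [|u];
    last by rewrite inE.
  apply: eq_bigr => u _; rewrite -(E u) sum1dep_card.
  by apply: eq_card => x; rewrite inE eq_sym [in RHS]inE.
apply/dvdnP; exists m; apply/eqP; rewrite -(eqn_pmul2r (cardG_gt0 stab_group)) D.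
by rewrite -mulnA [X in (m * X)%N]mulnC (Lagrange (subsetT stab_group)) mulnC.
Qed.

(** The order of 1 + m modulo K divides #|V| = #|M| and also the index of K, hence #|M| - 1; so it
    is 1. *)
Let class_one_plus m : m \in M -> c (1 + m) = c 1.
Proof.
move=> Mm; pose v := FinRing.unit R (unit_one_plus Mm).
suff : v \in K by rewrite KP => /eqP.
have Vv : v \in V by rewrite VP /= addrAC subrr add0r.
pose G := [set: {unit R}]%G.
have nKG : (stab_group <| G)%g.
  rewrite -sub_abelian_normal ?subsetT //.
  by apply/centsP => a _ b _; apply: val_inj; rewrite !FinRing.val_unitM mulrC.
have NKv : (v \in 'N(stab_group))%g by rewrite (subsetP (normal_norm nKG)) ?inE.
apply/coset_idr => //; apply/eqP; rewrite -order_eq1 -dvdn1.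
suff <- : gcdn #|M| #|M :\ 0%R| = 1%N.
  rewrite dvdn_gcd; apply/andP; split.
    apply: dvdn_trans (morph_order _ NKv) _.
    by rewrite -card_V (@order_dvdG _ one_plus_group).
  apply: dvdn_trans index_dvd; rewrite -card_quotient ?normal_norm //.
  by apply: order_dvdG; rewrite mem_quotient ?inE.
by apply/eqP; rewrite -[_ == _]/(coprime _ _) (cardsD1 0 M) M0 add1n coprimeSn.
Qed.

Let class_translate x m : x \notin M -> m \in M -> c (x + m) = c x.
Proof.
rewrite inM negbK => Ux Mm.
have -> : x + m = x * (1 + x^-1 * m) by rewrite mulrDr mulr1 mulVKr.
by rewrite (class_unit cP Ux (class_one_plus (mulM _ Mm))) mulr1.
Qed.

(* Outside M every class X is a union of cosets of M, so X meets each of its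
   translates by an element of M in at least #|X \ M| points; as every
   nonzero class meets M, this holds for all translates, and summing over
   them bounds #|X| from below by about half of #|R|. *)
Lemma local_ring_classes h x y :
  h \in M -> h != 0 -> x != 0 -> y != 0 -> c x = c y.
Proof.
move=> Mh h0 x0 y0; apply/eqP; case: eqP => // cxy; exfalso.
pose X w := [set z | c z == c w].
have XP w z : (z \in X w) = (c z == c w) by rewrite inE.
clearbody X.
have satX w : saturated c (X w) by move=> z z' czz'; rewrite !XP czz'.
have X0 w : w != 0 -> 0 \notin X w.
  by rewrite XP => /eqP w0; apply/eqP => /esym /(class_eq0 cP).
(* Two distinct nonzero classes are disjoint and miss 0, so one of them has at most half of the
   nonzero elements. *)
wlog small : x y x0 y0 cxy / (2 * #|X x| <= #|R|.-1)%N => [W|].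
  have dXY : [disjoint X x & X y].
    rewrite -setI_eq0; apply/eqP/setP => z; rewrite in_setI in_set0 !XP.
    by apply/andP => -[/eqP zx /eqP zy]; apply: cxy; rewrite -zx -zy.
  have : (#|X x| + #|X y| <= #|R|.-1)%N.
    rewrite -(leq_add2l 1) -cardsUI (disjoint_setI0 dXY) cards0 addn0.
    have := max_card (mem (0 |: (X x :|: X y))).
    by rewrite cardsU1 in_setU negb_or !X0 //= => le; have := leq_trans le (leqSpred _).
  have [le1|lt1] := leqP (2 * #|X x|) (#|R|.-1); first by case: (W x y).
  have [le2|lt2] := leqP (2 * #|X y|) (#|R|.-1); last by move: lt1 lt2; clear; lia.
  by case: (W y x) => // /esym.
(* A class missing M would have every u * h as a period, although it contains w and not 0. *)
have meetsM w : w != 0 -> exists2 k, k \in M & c k = c w.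
  move=> w0; case: (pickP (fun k => (k \in M) && (c k == c w))) => [k|none].
    by move=> /andP[Mk /eqP ck]; exists k.
  exfalso; case: (saturated_periodic cP prim (satX w) h0) => [u z Uu| |] .
  - rewrite !XP => /eqP cz; rewrite class_translate ?cz ?mulM //.
    by have := none z; rewrite cz eqxx andbT => ->.
  - by move/setP/(_ w); rewrite XP eqxx in_set0.
  - by move/setP/(_ 0); rewrite (negPf (X0 w w0)) inE.
have tr_count g : g != 0 ->
    (#|X x :\: M| <= #|[set z in X x | (z - g)%R \in X x]|)%N.
  move=> /meetsM[k Mk /esym ck]; rewrite (translate_count cP (satX x) ck).
  apply/subset_leq_card/subsetP => z; rewrite in_setD => /andP[Mz Xz].
  rewrite in_set Xz /= XP class_translate -?XP //.
  by rewrite -mulN1r mulM.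
have total : (\sum_g #|[set z in X x | (z - g)%R \in X x]| = #|X x| * #|X x|)%N.
  transitivity (\sum_g \sum_(z in X x | (z - g)%R \in X x) 1)%N.
    by apply: eq_bigr => g _; rewrite sum1dep_card; apply: eq_card => z; rewrite !in_set.
  rewrite (exchange_big_dep (mem (X x))) //=; last by move=> g z _ /andP[].
  rewrite -sum_nat_const; apply: eq_bigr => z Xz.
  rewrite sum1dep_card -[RHS](card_imset _ (can_inj (subKr z))); apply: eq_card => w.
  rewrite inE Xz; apply/idP/imsetP => [H|[v Xv ->]]; last by rewrite opprB addrC subrK.
  by exists (z - w); rewrite // opprB addrC subrK.
have [u Uu cu] := class_meets_units x0.
have Mu : u \notin M by rewrite inM Uu.
have big : (#|M| <= #|X x :\: M|)%N.
  rewrite -(card_imset _ (addrI u)); apply/subset_leq_card/subsetP => _ /imsetP[m Mm ->].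
  rewrite in_setD XP class_translate // cu eqxx andbT.
  apply: contra Mu => Mum; rewrite -(addrK m u) -mulN1r.
  by apply: addM => //; exact: mulM.
have few : (#|X x :&: M| < #|M|)%N.
  apply: proper_card; apply/properP; split; first exact: subsetIr.
  by exists 0; rewrite ?M0 // in_setI negb_and X0.
have lower : (#|X x| + #|R|.-1 * #|X x :\: M| <= #|X x| * #|X x|)%N.
  rewrite -total (bigD1 0) //=; apply: leq_add.
    by apply/subset_leq_card/subsetP => z Xz; rewrite inE subr0 Xz.
  have -> : #|R|.-1 = #|[pred g : R | g != 0]| by rewrite (cardC1 (0 : R)).
  rewrite -sum_nat_const; apply: leq_sum => g; exact: tr_count.
(* [few] and [big] give #|X x| < 2 * #|X x :\: M|. With [small], the product #|R|.-1 * #|X x :\: M|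
   is then at least the square of #|X x|, and [lower] fails as X x is nonempty. *)
have := cardsID M (X x); move: small lower big few.
move: #|X x| #|_ :&: _| #|_ :\: _| #|M| (#|R|.-1); clear=> a b d e n; nia.
Qed.

End LocalRing.

(** * Characters of the additive group *)

Section AdditiveCharacters.

Variable R : finComUnitRingType.
Implicit Types (i j k : Iirr [set: R]) (x y : R).

Definition addchar i x : algC := 'chi_i x.

Let abelianR : abelian [set: R].
Proof. by apply/centsP => x _ y _; exact: addrC. Qed.

Let addchar_lin i : 'chi[[set: R]]_i \is a linear_char.
Proof. exact: char_abelianP. Qed.

Lemma addcharD i x y : addchar i (x + y) = addchar i x * addchar i y.
Proof. by rewrite /addchar -(lin_charM (addchar_lin i)) ?inE. Qed.

Lemma addchar0 i : addchar i 0 = 1.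
Proof. exact: (lin_char1 (addchar_lin i)). Qed.

Lemma addcharMn i x n : addchar i (x *+ n) = addchar i x ^+ n.
Proof. by rewrite /addchar -(lin_charX (addchar_lin i)) ?inE. Qed.

Lemma addchar_Aint i x : addchar i x \in Aint.
Proof. exact: Aint_irr. Qed.

Lemma card_ring_neq0 : #|R|%:R != 0 :> algC.
Proof. by rewrite pnatr_eq0 -lt0n; apply/card_gt0P; exists 0. Qed.

Lemma addchar_orthogonality x y :
  \sum_i addchar i x * addchar i (- y) = #|R|%:R *+ (x == y).
Proof.
have := second_orthogonality_relation x (in_setT y).
rewrite (setIidPl _) ?cardsT; last by rewrite sub_cent1 (subsetP abelianR) ?inE.
rewrite (elimT (abelian_classP _) abelianR y (in_setT y)) inE => <-.
apply: eq_bigr => i _; by rewrite -(lin_charV_conj (addchar_lin i)) ?inE.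
Qed.

Lemma addchar_mul i j : exists k, forall x, addchar k x = addchar i x * addchar j x.
Proof.
have /irrP[k kE] := mul_lin_irr (addchar_lin i) (mem_irr j).
by exists k => x; rewrite /addchar -kE cfunE.
Qed.

(** A normal subgroup is the intersection of the kernels of the irreducible characters trivial on
    it. *)
Lemma addchar_separates (M : {set R}) x :
  0 \in M -> add_closed M -> x \notin M ->
  exists i, (forall y, y \in M -> addchar i y = 1) /\ addchar i x != 1.
Proof.
move=> M0 addM Mx.
have gM : group_set M by apply/group_setP; split=> // y z; exact: addM.
have nM : (Group gM <| [set: R])%g by rewrite -sub_abelian_normal ?subsetT.
have /exists_inP[i Mi kx] :
    [exists (i | M \subset cfker 'chi[[set: R]]_i), x \notin cfker 'chi_i].
  apply: contraR Mx; rewrite negb_exists_in => /forall_inP ker_x.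
  rewrite -[M]/(gval (Group gM)) -(cap_cfker_normal nM).
  by apply/bigcapP => i /ker_x; rewrite negbK.
exists i; split=> [y /(subsetP Mi)|]; last apply: contra kx.
  by rewrite cfkerEirr !inE => /eqP; rewrite (lin_char1 (addchar_lin i)).
by rewrite cfkerEirr !inE (lin_char1 (addchar_lin i)).
Qed.

End AdditiveCharacters.

(** * Frobenius congruences between algebraic integers *)

Section Frobenius.

Variable p : nat.
Hypothesis p_pr : prime p.

Lemma eqAmodX (e : algC) (x y : algC) n :
  x \in Aint -> y \in Aint -> (x == y %[mod e])%A -> (x ^+ n == y ^+ n %[mod e])%A.
Proof.
move=> Zx Zy exy; elim: n => [|n IH]; first by rewrite !expr0 eqAmod_refl.
by rewrite !exprS eqAmodM ?rpredX.
Qed.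

Lemma eqAmod_frobenius (x y : algC) : x \in Aint -> y \in Aint ->
  ((x + y) ^+ p == x ^+ p + y ^+ p %[mod p])%A.
Proof.
move=> Zx Zy; rewrite exprDn; case: p p_pr => // n n_pr.
rewrite big_ord_recl big_ord_recr /= subn0 bin0 subnn binn !expr0 mulr1 mul1r !mulr1n.
rewrite addrA -[X in (_ == X %[mod _])%A]addr0 addrAC eqAmodDl eqAmod0.
apply: rpred_sum => i _; rewrite -mulr_natr -eqAmod0.
have /dvdnP[d ->] : (n.+1 %| 'C(n.+1, bump 0 i))%N.
  by rewrite prime_dvd_bin // /bump /= add1n ltnS ltn_ord.
by rewrite natrM mulrA eqAmodMl0 // !(rpredM, rpredX) ?rpred_nat.
Qed.

Lemma eqAmod_frobenius_iter k (x y : algC) : x \in Aint -> y \in Aint ->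
  ((x + y) ^+ (p ^ k) == x ^+ (p ^ k) + y ^+ (p ^ k) %[mod p])%A.
Proof.
move=> Zx Zy; elim: k => [|k IH]; first by rewrite !expn0 !expr1 eqAmod_refl.
rewrite expnSr !exprM; apply: (eqAmod_trans (eqAmodX _ _ _ IH)).
- by rewrite rpredX ?rpredD.
- by rewrite rpredD ?rpredX.
- by apply: eqAmod_frobenius; rewrite rpredX.
Qed.

Lemma eqAmod_frobenius_sum k (I : Type) (r : seq I) (P : pred I) (F : I -> algC) :
  (forall i, F i \in Aint) ->
  ((\sum_(i <- r | P i) F i) ^+ (p ^ k) ==
     \sum_(i <- r | P i) F i ^+ (p ^ k) %[mod p])%A.
Proof.
move=> ZF; elim: r => [|i r IH].
  by rewrite !big_nil expr0n expn_eq0 (gtn_eqF (prime_gt0 p_pr)); exact: eqAmod_refl.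
rewrite !big_cons; case: (P i) => //.
apply: eqAmod_trans (eqAmod_frobenius_iter _ _ _) _ => //; first exact: rpred_sum.
by rewrite eqAmodDl.
Qed.

End Frobenius.

(** * Fourier transform and idempotents of the S-ring *)

Section FourierTransform.

Variables (R : finComUnitRingType) (T : finType) (c : R -> T).
Hypothesis cP : class_map c.
Implicit Types (i j : Iirr [set: R]) (a b : R -> algC).

Definition fourier a i : algC := \sum_x a x * addchar i x.

Lemma fourier_inversion a x : \sum_i fourier a i * addchar i (- x) = #|R|%:R * a x.
Proof.
transitivity (\sum_y a y * \sum_i addchar i y * addchar i (- x)).
  under eq_bigr do rewrite mulr_suml; rewrite exchange_big; apply: eq_bigr => y _.
  by rewrite mulr_sumr; apply: eq_bigr => i _; rewrite mulrA.
rewrite (bigD1 x) //= addchar_orthogonality eqxx big1 ?addr0 1?mulrC // => y yx.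
by rewrite addchar_orthogonality (negPf yx) mulr0.
Qed.

Lemma class_function_factor a : (forall x y, c x = c y -> a x = a y) ->
  exists f : T -> algC, a =1 f \o c.
Proof.
(* The default 0 concerns only values t that [c] does not take. *)
move=> ac; exists (fun t => if [pick x | c x == t] is Some x then a x else 0) => x /=.
case: pickP => [y /eqP cy|/(_ x)]; last by rewrite eqxx.
exact/esym/ac.
Qed.

Lemma fourier_convolution a b i :
  fourier (fun z => \sum_x a x * b (z - x)) i = fourier a i * fourier b i.
Proof.
rewrite /fourier mulr_suml; under eq_bigr do rewrite mulr_suml.
rewrite exchange_big; apply: eq_bigr => x _ /=; rewrite mulr_sumr.
rewrite (reindex_inj (addrI x)); apply: eq_bigr => y _ /=.
by rewrite addrC addKr addcharD; ring.
Qed.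

Variable i0 : Iirr [set: R].

Definition same_class_sums : {set Iirr [set: R]} :=
  [set i | [forall x, fourier (fun y => (c y == c x)%:R) i ==
                      fourier (fun y => (c y == c x)%:R) i0]].

(* Up to the factor #|R|, the primitive idempotent of the S-ring on which the
   character i0 does not vanish. *)
Definition class_idempotent x : algC := \sum_(i in same_class_sums) addchar i (- x).

(** Interpolation: a convolution of class functions is a class function, and its transform is the
    product of the transforms. One factor is taken for each j in s, with value 1 on
    [same_class_sums] and 0 at j. *)
Lemma same_class_sums_separation (s : seq (Iirr [set: R])) :
  {in s, forall i, i \notin same_class_sums} ->
  exists f : T -> algC, {in same_class_sums, forall i, fourier (f \o c) i = 1} /\
                        {in s, forall i, fourier (f \o c) i = 0}.
Proof.
(* The class of 0 is {0}, so its indicator has transform 1 everywhere and plays the constants in the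
   interpolation. *)
have delta i : fourier (fun y => (c y == c 0)%:R) i = 1.
  rewrite /fourier (bigD1 0) //= eqxx addchar0 mul1r big1 ?addr0 // => x x0.
  by case: eqP => [/(class_eq0 cP)/eqP|_]; rewrite ?(negPf x0) ?mul0r.
elim: s => [|j s IH] sE.
  exists (fun t => (t == c 0)%:R); split=> // i _; exact: delta.
have [|f [f1 f0]] := IH; first by move=> i si; apply: sE; rewrite inE si orbT.
have : j \notin same_class_sums by apply: sE; rewrite inE eqxx.
rewrite inE negb_forall => /existsP[x]; set S := fourier _ => Sj.
have d0 : S i0 - S j != 0 by rewrite subr_eq0 eq_sym.
pose g t : algC := ((t == c x)%:R - S j * (t == c 0)%:R) / (S i0 - S j).
have gE i : fourier (g \o c) i = (S i - S j) / (S i0 - S j).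
  have <- : fourier (fun y => (c y == c x)%:R - S j * (c y == c 0)%:R) i = S i - S j.
    rewrite -[in RHS](mulr1 (S j)) -[in RHS](delta i) [in RHS]mulr_sumr -sumrB.
    by apply: eq_bigr => y _; rewrite mulrBl mulrA.
  by rewrite /fourier mulr_suml; apply: eq_bigr => y _; rewrite mulrAC.
have [h hE] := class_function_factor (class_convolution cP f g).
have hF i : fourier (h \o c) i = fourier (f \o c) i * fourier (g \o c) i.
  by rewrite -fourier_convolution; apply: eq_bigr => y _; rewrite /= -[h _]hE.
exists h; split=> i.
  move=> Ei; rewrite hF f1 // mul1r gE.
  have -> : S i = S i0 by move: Ei; rewrite inE => /forallP/(_ x)/eqP.
  by rewrite divff.
rewrite inE hF => /predU1P[->|/f0->]; last by rewrite mul0r.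
by rewrite gE subrr mul0r mulr0.
Qed.

(** Interpolation against all characters outside [same_class_sums] gives a class function whose
    transform is the indicator of that set; by inversion, the idempotent is #|R| times it. *)
Lemma class_idempotent_spec :
  (forall x y, c x = c y -> class_idempotent x = class_idempotent y) /\
  (forall i, fourier class_idempotent i = #|R|%:R *+ (i \in same_class_sums)).
Proof.
have [|f [f1 f0]] := @same_class_sums_separation (enum (~: same_class_sums)).
  by move=> i; rewrite mem_enum inE.
have fE i : fourier (f \o c) i = (i \in same_class_sums)%:R.
  have [/f1//|Ei] := boolP (i \in _); apply: f0.
  by rewrite mem_enum inE.
have FE x : class_idempotent x = #|R|%:R * f (c x).
  rewrite -[f (c x)]/((f \o c) x) -fourier_inversion /class_idempotent.
  rewrite big_mkcond; apply: eq_bigr => i _.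
  by rewrite fE; case: ifP; rewrite ?mul1r ?mul0r.
split=> [x y cxy|i]; first by rewrite !FE cxy.
rewrite -mulr_natr -fE /fourier mulr_sumr; apply: eq_bigr => x _.
by rewrite FE mulrA.
Qed.

End FourierTransform.

(** * Fused classes in a ring with a local p-component *)

Section IdempotentSplitting.

Variables (R : finComUnitRingType) (T : finType) (c : R -> T).
Hypotheses (cP : class_map c) (prim : class_primitive c).
Hypothesis c_stable : forall u x, u \is a GRing.unit -> c (u * x) = c x.

(** Here e is the identity of the p-component e R, and M is the preimage in R of the maximal ideal
    of e R; hence M contains 1 - e. *)
Variables (p k n' : nat) (e : R) (M : {set R}).
Hypotheses (p_pr : prime p) (n'_coprime : ~~ (p %| n')%N).
Hypotheses (e_idem : e * e = e) (e_exp : e *+ (p ^ k) = 0).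
Hypothesis card_eR : #|[set e * x | x : R]| = (p ^ k)%N.
Hypothesis cardR : #|R| = (p ^ k * n')%N.
Hypotheses (M0 : 0 \in M) (addM : add_closed M).
Hypothesis mulM : forall x y, y \in M -> x * y \in M.
Hypotheses (eM : e \notin M) (fM : 1 - e \in M).
Hypothesis invM : forall x, x \notin M -> exists y, e * x * y = e.

Let f := 1 - e.
Let ef : e * f = 0. Proof. by rewrite mulrBr mulr1 e_idem subrr. Qed.
Let ff : f * f = f. Proof. by rewrite mulrBl mul1r ef subr0. Qed.
Let e_plus_f x : x = e * x + f * x. Proof. by rewrite /f; ring. Qed.

Let oppM x : (- x \in M) = (x \in M).
Proof. by apply/idP/idP => /(mulM (-1)); rewrite mulN1r ?opprK. Qed.

Let e_char i x : (forall y, addchar i (e * y) = 1) -> addchar i (f * x) = addchar i x.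
Proof. by move=> ie; rewrite [in RHS](e_plus_f x) addcharD ie mul1r. Qed.

(** The unit equal to y / x on the e-component and to 1 on the f-component carries x to y. *)
Lemma class_complement x y : x \notin M -> y \notin M -> f * x = f * y -> c x = c y.
Proof.
move=> /invM[x' xx'] /invM[y' yy'] fxy.
have E : (e * (y * x') + f) * x = y.
  rewrite mulrDl fxy [in RHS](e_plus_f y) -[X in _ = X * y + _]xx'; ring.
rewrite -E c_stable //; apply/unitrPr; exists (e * (x * y') + f).
have -> : (e * (y * x') + f) * (e * (x * y') + f) =
   (e * x * x') * (e * y * y') + (e * f) * (y * x') + (e * f) * (x * y') + f * f.
  by ring.
by rewrite xx' yy' ef ff e_idem !mul0r !addr0 /f; ring.
Qed.

(** The fibres of x |-> f * x are cosets of e R. Their size is the modulus in the congruence between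
    characters. *)
Lemma sum_complement (h : R -> algC) :
  \sum_x h (f * x) = (p ^ k)%:R * \sum_(z in [set f * x | x : R]) h z.
Proof.
rewrite (partition_big (fun x => f * x) (mem [set f * x | x : R])) => [|x _]; last first.
  exact: imset_f.
rewrite mulr_sumr; apply: eq_bigr => _ /imsetP[x _ ->].
rewrite (eq_bigr (fun=> h (f * x))) => [|y /eqP-> //].
rewrite sumr_const mulr_natl -card_eR -(card_imset _ (addrI (f * x))); congr (_ *+ _).
apply: eq_card => y; apply/eqP/imsetP => [fyx|[_ /imsetP[z _ ->] ->]].
  by exists (e * y); rewrite ?imset_f // -fyx addrC -e_plus_f.
by rewrite mulrDr mulrA ff mulrA [f * e]mulrC ef mul0r addr0.
Qed.

(** Translation by e * x0 preserves f * x, and so multiplies the sum by a factor other than 1. *)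
Lemma sum_complement_twisted (h : R -> algC) i x0 : addchar i (e * x0) != 1 ->
  \sum_x h (f * x) * addchar i x = 0.
Proof.
move=> i1; set S := \sum_x _; have : S * (addchar i (e * x0) - 1) = 0.
  rewrite mulrBr mulr1; apply/eqP; rewrite subr_eq0; apply/eqP.
  rewrite /S mulr_suml [RHS](reindex_inj (addIr (e * x0))); apply: eq_bigr => x _ /=.
  by rewrite mulrDr mulrA [f * e]mulrC ef mul0r addr0 addcharD mulrA.
by move/eqP; rewrite mulf_eq0 subr_eq0 (negPf i1) orbF => /eqP.
Qed.

(** The difference is the sum of a x * i0 x * (1 - j x). Terms with x in M vanish; for the others
    [class_complement] replaces a x by a (e + f * x). The part with j then sums to 0 by
    [sum_complement_twisted], and the rest is given by [sum_complement]. *)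
Lemma fourier_difference (a : R -> algC) i0 i1 j :
  (forall x y, c x = c y -> a x = a y) ->
  (forall x, addchar i0 (e * x) = 1) ->
  (forall x, x \in M -> addchar j x = 1) -> (exists x, addchar j x != 1) ->
  (forall x, addchar i1 x = addchar i0 x * addchar j x) ->
  fourier a i0 - fourier a i1 =
    (p ^ k)%:R * \sum_(z in [set f * x | x : R]) a (e + z) * addchar i0 z.
Proof.
move=> ac i0e jM [x0 jx0] i1E.
pose h z := a (e + z) * addchar i0 z.
rewrite -(sum_complement h).
have jex0 : addchar j (e * x0) != 1.
  move: jx0; rewrite {1}(e_plus_f x0) addcharD [addchar j (f * x0)]jM ?mulr1 //.
  by rewrite mulrC mulM.
rewrite /fourier -[RHS]subr0 -[X in _ = _ - X](sum_complement_twisted h jex0) -!sumrB.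
apply: eq_bigr => x _; rewrite i1E mulrA -[X in X - _]mulr1 -mulrBr.
rewrite -[X in _ = X - _]mulr1 -mulrBr.
have [/jM->|Mx] := boolP (x \in M); first by rewrite subrr !mulr0.
congr (_ * _); rewrite /h e_char //; congr (_ * _); apply/ac/class_complement => //.
  apply: contra eM => Mex; rewrite -(addrK (f * x) e); apply: addM => //.
  by rewrite oppM mulrC mulM.
by rewrite mulrDr [f * e]mulrC ef add0r mulrA ff.
Qed.

(** * From congruent to equal character values on class sums *)

Section CongruentCharacters.

Variables (i0 i1 j : Iirr [set: R]).
Hypotheses (i0e : forall x, addchar i0 (e * x) = 1)
           (i0f : exists x, addchar i0 x != 1)
           (jM : forall x, x \in M -> addchar j x = 1)
           (j_nontriv : exists x, addchar j x != 1)
           (i1E : forall x, addchar i1 x = addchar i0 x * addchar j x).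

Let E := same_class_sums c i0.
Let F := class_idempotent c i0.

Let Fc x y : c x = c y -> F x = F y.
Proof. by have [Fc _] := class_idempotent_spec cP i0; exact: Fc. Qed.

Let fourierF i : fourier F i = #|R|%:R *+ (i \in E).
Proof. by have [_ ->] := class_idempotent_spec cP i0. Qed.

Let ZF x : F x \in Aint.
Proof. by apply: rpred_sum => i _; exact: addchar_Aint. Qed.

Let F0 : F 0 = #|E|%:R.
Proof.
rewrite /F /class_idempotent oppr0 (eq_bigr (fun=> 1)) ?sumr_const // => i _.
by rewrite addchar0.
Qed.

Let F_pow x : (F x ^+ (p ^ k) == F (x *+ (p ^ k)) %[mod p])%A.
Proof.
apply: eqAmod_trans (eqAmod_frobenius_sum p_pr _ _ _ _) _.
  by move=> i; exact: addchar_Aint.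
under eq_bigr do rewrite -addcharMn mulNrn.
exact: eqAmod_refl.
Qed.

(* x |-> F (x *+ p ^ k) is constant mod p on classes and has e as a period. *)
Let F_const x : (F (x *+ (p ^ k)) == #|E|%:R %[mod p])%A.
Proof.
pose Y := [set x | (F (x *+ (p ^ k)) == #|E|%:R %[mod p])%A].
have YE z : (z \in Y) = (F (z *+ (p ^ k)) == #|E|%:R %[mod p])%A by rewrite inE.
have satY : saturated c Y.
  move=> y z cyz; rewrite !YE; apply: eqAmod_trans.
  rewrite eqAmod_sym; apply: eqAmod_trans (F_pow z).
  by rewrite -(Fc cyz) eqAmod_sym F_pow.
have e0 : e != 0 by apply: contra eM => /eqP->.
case: (saturated_periodic cP prim satY e0) => [u z _|Y0|YT].
- by rewrite !YE mulrnDl -mulrnAr e_exp mulr0 addr0.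
- have : 0 \in Y by rewrite YE mul0rn F0 eqAmod_refl.
  by rewrite Y0 inE.
- by rewrite -YE YT inE.
Qed.

Let b x : algC := F x - #|E|%:R.

Let Zb x : b x \in Aint. Proof. by rewrite rpredB ?rpred_nat. Qed.

Let b_pow x : (b x ^+ (p ^ k) == 0 %[mod p])%A.
Proof.
pose N : algC := #|E|%:R; have ZN : N \in Aint by exact: rpred_nat.
have N_pow : (N ^+ (p ^ k) == N %[mod p])%A.
  (* Fermat's congruence is the Frobenius congruence for N as a sum of ones. *)
  have {1}-> : N = \sum_(i in E) 1 by rewrite sumr_const.
  apply: eqAmod_trans (eqAmod_frobenius_sum p_pr _ _ _ _) _ => [i|]; first exact: rpred1.
  by rewrite (eq_bigr (fun=> 1)) ?sumr_const ?eqAmod_refl // => i _; rewrite expr1n.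
rewrite -(eqAmodDr _ (N ^+ (p ^ k))) add0r.
have := eqAmod_frobenius_iter p_pr k (Zb x) ZN; rewrite subrK eqAmod_sym => H.
apply: eqAmod_trans H _; apply: eqAmod_trans (F_pow x) _.
by apply: eqAmod_trans (F_const x) _; rewrite eqAmod_sym.
Qed.

Let nontriv_sum (i : Iirr [set: R]) :
  (exists x, addchar i x != 1) -> \sum_x addchar i x = 0.
Proof.
case=> x0 ix0; set S := \sum_x _; have : S * (addchar i x0 - 1) = 0.
  rewrite mulrBr mulr1; apply/eqP; rewrite subr_eq0; apply/eqP.
  rewrite /S mulr_suml [RHS](reindex_inj (addIr x0)); apply: eq_bigr => x _ /=.
  by rewrite addcharD.
by move/eqP; rewrite mulf_eq0 subr_eq0 (negPf ix0) orbF => /eqP.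
Qed.

(** Subtracting a constant from F changes its transform only at the trivial character. *)
Let fourier_b (i : Iirr [set: R]) :
  (exists x, addchar i x != 1) -> fourier b i = #|R|%:R *+ (i \in E).
Proof.
move=> /nontriv_sum sum0; rewrite -fourierF -[RHS]subr0 -[X in _ - X](mulr0 #|E|%:R).
rewrite -[X in _ * X]sum0 mulr_sumr /fourier -sumrB.
by apply: eq_bigr => x _; rewrite mulrBl.
Qed.

Let i1_nontriv : exists x, addchar i1 x != 1.
Proof.
have [x0 jx0] := j_nontriv; exists (e * x0); rewrite i1E i0e mul1r.
move: jx0; rewrite {1}(e_plus_f x0) addcharD [addchar j (f * x0)]jM ?mulr1 //.
by rewrite mulrC mulM.
Qed.

(** Otherwise [fourier_difference] for b, divided by p ^ k, writes n' as a sum of multiples of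
    values of b. Raised to the power p ^ k, this sum is 0 modulo p by [b_pow], but p does not divide
    n'. *)
Lemma congruent_characters : i1 \in E.
Proof.
apply: contraT => i1E'.
have bc x y : c x = c y -> b x = b y by rewrite /b => /Fc->.
have := fourier_difference bc i0e jM j_nontriv i1E.
rewrite !fourier_b // (negPf i1E') mulr0n subr0.
have -> : i0 \in E by rewrite inE; apply/forallP => x.
rewrite mulr1n cardR natrM; have pk0 : (p ^ k)%:R != 0 :> algC.
  by rewrite pnatr_eq0 expn_eq0 (gtn_eqF (prime_gt0 p_pr)).
move/(mulfI pk0) => n'E; case/negP: n'_coprime.
suff : (p %| n' ^ (p ^ k))%N by rewrite Euclid_dvdX // => /andP[].
rewrite -eqAmod0_nat -[X in eqAmod _ X _]/((n' ^ p ^ k)%N%:R : algC) natrX n'E.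
apply: eqAmod_trans (eqAmod_frobenius_sum p_pr _ _ _ _) _ => [z|].
  by rewrite rpredM ?addchar_Aint.
rewrite eqAmod0; apply: rpred_sum => z _.
rewrite -eqAmod0 exprMn -(mul0r (addchar i0 z ^+ (p ^ k))).
by rewrite eqAmodMr ?rpredX ?addchar_Aint.
Qed.

End CongruentCharacters.

(** The function w has zero transform at nontrivial characters i: by [sum_complement_twisted] if i
    is nontrivial on e R, and otherwise because i and i * j agree on the class of e, so that
    [fourier_difference] vanishes. Hence w is constant, and w 0 = 1. *)
Lemma class_e_plus_complement x : c (e + f * x) = c e.
Proof.
pose w y : algC := (c (e + f * y) == c e)%:R.
have fourier_w i : fourier w i = 0 \/ (forall y, addchar i y = 1).
  have [/forallP ie|] := boolP [forall y, addchar i (e * y) == 1]; last first.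
    rewrite negb_forall => /existsP[x0 ix0]; left.
    rewrite -(sum_complement_twisted (fun z => (c (e + z) == c e)%:R) ix0).
    exact: eq_bigr.
  have {}ie y : addchar i (e * y) = 1 by apply/eqP.
  have [/forallP i1|] := boolP [forall y, addchar i y == 1].
    by right=> y; apply/eqP.
  rewrite negb_forall => /existsP/= i_nontriv; left.
  have [j [jM je]] := addchar_separates M0 addM eM.
  have [i1 i1E] := addchar_mul i j.
  have := congruent_characters ie i_nontriv jM (ex_intro _ e je) i1E.
  rewrite inE => /forallP/(_ e)/eqP E1.
  pose a y : algC := (c y == c e)%:R.
  have ac y z : c y = c z -> a y = a z by rewrite /a => ->.
  have := fourier_difference ac ie jM (ex_intro _ e je) i1E.
  rewrite /a E1 subrr -(sum_complement (fun z => (c (e + z) == c e)%:R * addchar i z)).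
  move=> sum0; rewrite [RHS]sum0; apply: eq_bigr => y _ /=.
  by rewrite /w e_char.
have : #|R|%:R * w x = #|R|%:R * w 0.
  rewrite -!fourier_inversion; apply: eq_bigr => i _.
  by have [->|i1] := fourier_w i; rewrite ?mul0r // !i1.
move/(mulfI (card_ring_neq0 R)).
rewrite /w mulr0 addr0 eqxx; case: eqP => // _ /eqP.
by rewrite eq_sym oner_eq0.
Qed.

Lemma idempotent_splitting_classes x y : x != 0 -> y != 0 -> c x = c y.
Proof.
have M1 : 1 \notin M by apply: contra eM => /(mulM e); rewrite mulr1.
have outside z : z \notin M -> c z = c e.
  move=> Mz; rewrite -(class_e_plus_complement z); apply: class_complement => //.
    apply: contra eM => Mez; rewrite -(addrK (f * z) e); apply: addM => //.
    by rewrite oppM mulrC mulM.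
  by rewrite mulrDr [f * e]mulrC ef add0r mulrA ff.
have nonzero z : z != 0 -> c z = c e.
  move=> z0; have unM : unit_stable M by move=> u t _; exact: mulM.
  by have [t <- /outside] := class_meets_complement cP prim M0 addM unM M1 z0.
by move=> x0 y0; rewrite !nonzero.
Qed.

End IdempotentSplitting.

(** * Fusing classes under the units *)

Section UnitClasses.

Variables (R : finComUnitRingType) (T : finType) (c : R -> T).
Hypotheses (cP : class_map c) (prim : class_primitive c).

Definition unit_classes (x : R) : {set T} := [set c (u * x) | u in GRing.unit].

Lemma unit_classesP x y :
  reflect (exists2 u, u \is a GRing.unit & c (u * x) = c y)
          (unit_classes x == unit_classes y).
Proof.
apply: (iffP eqP) => [xy|[u Uu cu]].
  have : c (1 * y) \in unit_classes x by rewrite xy imset_f // unitr1.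
  by case/imsetP=> u Uu cu; exists u; rewrite // -cu mul1r.
apply/setP => t; apply/imsetP/imsetP => -[v Uv ->].
  exists (v / u); first by rewrite unitrM Uv unitrV.
  have Uvu : v / u \is a GRing.unit by rewrite unitrM Uv unitrV.
  by rewrite -(class_unit cP Uvu cu) mulrA divrK.
exists (v * u); first by rewrite unitrM Uv.
by rewrite -(class_unit cP Uv cu) mulrA.
Qed.

Lemma unit_classes_stable u x :
  u \is a GRing.unit -> unit_classes (u * x) = unit_classes x.
Proof.
move=> Uu; apply/eqP; rewrite eq_sym; apply/unit_classesP; by exists u.
Qed.

Lemma unit_classes_refine x y : c x = c y -> unit_classes x = unit_classes y.
Proof. by move=> cxy; apply/eqP/unit_classesP; exists 1; rewrite ?unitr1 // mul1r. Qed.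

(** Fused classes are saturated for [c], so the count for z' equals that for u * z, where c (u * z)
    = c z'; multiplication by u matches the latter with the count for z. *)
Lemma unit_classes_map : class_map unit_classes.
Proof.
split=> [x /eqP/unit_classesP[u Uu /(class_eq0 cP) ux0]|u x y Uu|s t z z' /eqP].
- by rewrite -(mulKr Uu x) ux0 mulr0.
- by rewrite !unit_classes_stable.
move=> /unit_classesP[u Uu cuz].
pose Y r := [set x | unit_classes x == r].
have satY r : saturated c (Y r).
  by move=> x y /unit_classes_refine xy; rewrite !inE xy.
have E w : #|[set x | (unit_classes x == s) && (unit_classes (w - x) == t)]| =
           #|[set x in Y s | w - x \in Y t]|.
  by apply: eq_card => x; rewrite !inE.
rewrite (E z') -(saturated_count cP (satY s) (satY t) cuz) -E.
rewrite -[LHS](card_imset _ (mulrI Uu)); apply: eq_card => x.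
apply/imsetP/idP => [[y]|].
  by rewrite !inE => /andP[sy ty] ->; rewrite -mulrBr !unit_classes_stable ?sy.
rewrite !inE -{1 2}(mulVKr Uu x) -mulrBr !unit_classes_stable ?unitrV // => H.
exists (u^-1 * x); last by rewrite mulVKr.
by rewrite inE unit_classes_stable ?unitrV.
Qed.

Lemma unit_classes_primitive : class_primitive unit_classes.
Proof.
move=> N N0 addN unN satN; apply: prim => // x y /unit_classes_refine.
exact: satN.
Qed.

(* If e <> 1 is a nonzero idempotent and the units permute the nonzero classes
   transitively, the classes of e and of 1 - e are conjugate; since units of
   the form u e + (1 - e) fix 1 - e and those of the form e + u (1 - e) fix e,
   every unit preserves the class of 1 - e. *)
Lemma transitive_classes (e : R) x y : e * e = e -> e != 0 -> e != 1 ->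
  (forall x y, x != 0 -> y != 0 -> unit_classes x = unit_classes y) ->
  x != 0 -> y != 0 -> c x = c y.
Proof.
move=> e_idem e0 e1 trans; pose f := 1 - e.
have f0 : f != 0 by rewrite subr_eq0 eq_sym.
have ef : e * f = 0 by rewrite mulrBr mulr1 e_idem subrr.
suff fE z : z != 0 -> c z = c f by move=> x0 y0; rewrite !fE.
move=> z0; have /eqP/unit_classesP[u Uu <-] := trans _ _ f0 z0.
have /eqP/unit_classesP[v Uv cfe] := trans _ _ f0 e0.
pose u' := e + u * f.
have Uu' : u' \is a GRing.unit.
  apply/unitrPr; exists (e + u^-1 * f).
  have -> : (e + u * f) * (e + u^-1 * f) =
     e * e + (e * f) * (u + u^-1) + (u * u^-1) * (f * f) by ring.
  by rewrite e_idem ef mulrV // mul0r addr0 mul1r mulrBl mul1r ef subr0 addrC subrK.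
have ff : f * f = f by rewrite mulrBl mul1r ef subr0.
have -> : u * f = u' * f by rewrite mulrDl ef add0r -mulrA ff.
have cf : c (v^-1 * e) = c f.
  by rewrite -(mulKr Uv f); apply: class_unit; rewrite ?unitrV.
rewrite -(class_unit cP Uu' cf) mulrCA.
have -> // : u' * e = e by rewrite mulrDl e_idem -mulrA [f * e]mulrC ef mulr0 addr0.
Qed.

End UnitClasses.

(** * From S-rings to class maps and back *)

Section SchurRing.

Variables (R : finComUnitRingType) (A : sring R).

Definition basic_set (x : R) : {set R} := pblock (basic_sets A) x.

Let cover_basic : cover (basic_sets A) = [set: R].
Proof. by have /and3P[/eqP] := sring_partition A. Qed.

Let triv_basic : trivIset (basic_sets A).
Proof. by have /and3P[] := sring_partition A. Qed.

Lemma mem_basic_set x : x \in basic_set x.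
Proof. by rewrite mem_pblock cover_basic inE. Qed.

Lemma basic_setP x : basic_set x \in basic_sets A.
Proof. by rewrite pblock_mem // cover_basic inE. Qed.

Lemma basic_set_eq x y : (basic_set x == basic_set y) = (y \in basic_set x).
Proof. by rewrite eq_pblock // cover_basic inE. Qed.

Lemma def_basic_set X x : X \in basic_sets A -> (basic_set x == X) = (x \in X).
Proof.
move=> SX; apply/eqP/idP => [<-|Xx]; first exact: mem_basic_set.
exact: def_pblock.
Qed.

Lemma basic_set_eq0 x : basic_set x = basic_set 0 -> x = 0.
Proof.
have /eqP-> : basic_set 0 == [set 0] by rewrite (def_basic_set _ (sring_set1 A)) inE.
by have := mem_basic_set x => /[swap] ->; rewrite inE => /eqP.
Qed.

Lemma sring_elemsP (a : gring R) :
  a \in A <-> (forall x y, basic_set x = basic_set y -> a x = a y).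
Proof.
have [gA _ Agen] := sring_basis A; split=> [/Agen[d ->] x y xy|a_const].
  rewrite !sum_ffunE; apply: eq_bigr => X SX.
  rewrite !ffunMzE !ffunE -!def_basic_set //; by rewrite xy.
have addA : {in A &, forall b d, b - d \in A} by have [] := sring_subring A.
have zeroA : 0 \in A by rewrite -(subrr 1); apply: addA; have [] := sring_subring A.
have oppA b : b \in A -> - b \in A by move=> Ab; rewrite -sub0r addA.
have plusA b d : b \in A -> d \in A -> b + d \in A.
  by move=> Ab /oppA Ad; rewrite -(opprK d) addA.
have natA b n : b \in A -> b *+ n \in A.
  by move=> Ab; elim: n => [|n IH]; rewrite ?mulr0n // mulrS plusA.
have intA b (m : int) : b \in A -> b *~ m \in A.
  by move=> Ab; case: m => n; [exact: natA | apply/oppA/natA].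
(* The coefficient of X is the value of a at a point of X; the default 0 would concern an empty X,
   which is not a basic set. *)
have -> : a = \sum_(X in basic_sets A)
    gsum X *~ (if [pick x in X] is Some x then a x else 0).
  apply/ffunP => z; rewrite sum_ffunE (bigD1 (basic_set z)) ?basic_setP //=.
  rewrite big1 ?addr0 => [|X /andP[SX Xz]]; last first.
    rewrite ffunMzE ffunE -def_basic_set // eq_sym (negPf Xz) mul0rz //.
  rewrite ffunMzE ffunE mem_basic_set; case: pickP => [x|/(_ z)]; last first.
    by rewrite mem_basic_set.
  by rewrite -basic_set_eq => /eqP/a_const->; rewrite intz.
apply: (big_ind (fun b => b \in A)) => // X SX.
exact/intA/gA.
Qed.

(** For basic sets s and t the counts are coefficients of the product of their sums, an element of
    A; otherwise both counts are 0. *)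
Lemma sring_convolution s t z z' : basic_set z = basic_set z' ->
  #|[set x | (basic_set x == s) && (basic_set (z - x) == t)]| =
  #|[set x | (basic_set x == s) && (basic_set (z' - x) == t)]|.
Proof.
move=> czz'; have none r : r \notin basic_sets A -> forall x, (basic_set x == r) = false.
  by move=> Sr x; apply: contraNF Sr => /eqP <-; exact: basic_setP.
have [Ss|/none sF] := boolP (s \in basic_sets A); last first.
  by apply: eq_card => x; rewrite !inE sF.
have [St|/none tF] := boolP (t \in basic_sets A); last first.
  by apply: eq_card => x; rewrite !inE !tF !andbF.
have [gA _ _] := sring_basis A; have [_ _ mulA] := sring_subring A.
have /sring_elemsP/(_ z z' czz') := mulA _ _ (gA _ Ss) (gA _ St).
have E w : (gsum s * gsum t : gring R) w =
    #|[set x | (basic_set x == s) && (basic_set (w - x) == t)]|%:R.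
  rewrite ffunE -sum1dep_card natr_sum [RHS]big_mkcond /=; apply: eq_bigr => x _.
  rewrite !ffunE !def_basic_set // -[(x^-1 * w)%g]/(- x + w) [- x + w]addrC.
  by do 2!case: (_ \in _).
by rewrite !E => /eqP; rewrite eqr_nat => /eqP.
Qed.

Hypothesis A_inv : sring_over_ring A.

Lemma gring_act_eval (k : {perm R}) (a : gring R) x : gring_act k a (k x) = a x.
Proof.
rewrite sum_ffunE (bigD1 x) //= ffunMzE ffunE set11 intz big1 ?addr0 // => y yx.
by rewrite ffunMzE ffunE inE (inj_eq perm_inj) eq_sym (negPf yx) mul0rz.
Qed.

(** By invariance, the indicator of the basic set of u * x, pulled back along multiplication by u,
    lies in A and so agrees at x and y. *)
Lemma basic_set_unit u x y :
  u \is a GRing.unit -> basic_set x = basic_set y ->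
  basic_set (u * x) = basic_set (u * y).
Proof.
move=> Uu cxy.
pose k : {perm R} := perm (mulrI Uu).
have kE z : k z = u * z by rewrite permE.
have Kk : (k^-1)%g \in unit_perms R by rewrite groupV; apply/unit_permsP; exists u.
have [gA _ _] := sring_basis A.
have /(A_inv Kk) Ak : exists2 a, a \in A
    & gring_act k^-1 (gsum (basic_set (u * x))) = gring_act k^-1 a.
  by exists (gsum (basic_set (u * x))); rewrite // gA ?basic_setP.
have /sring_elemsP/(_ x y cxy) := Ak.
have ev (a : gring R) z : gring_act k^-1 a z = a (k z).
  by rewrite -{1}(permK k z) gring_act_eval.
rewrite !ev !kE !ffunE mem_basic_set => /esym uy.
by apply/eqP; rewrite basic_set_eq; case: (_ \in _) uy.
Qed.

Lemma sring_class_map : class_map basic_set.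
Proof.
split; [exact: basic_set_eq0 | exact: basic_set_unit | exact: sring_convolution].
Qed.

Hypothesis A_prim : quasiprimitive A.

Lemma quasiprimitive_class_primitive : class_primitive basic_set.
Proof.
move=> N N0 addN unN satN.
have gN : group_set N by apply/group_setP; split=> // x y; exact: addN.
have sub : sring_subgroup A (Group gN).
  exists [set X in basic_sets A | X \subset N].
    by apply/subsetP => X; rewrite inE => /andP[].
  apply/setP => x; apply/idP/bigcupP => [Nx|[X]]; last first.
    by rewrite inE => /andP[_ /subsetP]; apply.
  exists (basic_set x); last exact: mem_basic_set.
  rewrite inE basic_setP; apply/subsetP => y; rewrite -basic_set_eq => /eqP cxy.
  exact: satN cxy Nx.
have inv : {in unit_perms R, forall k : {perm R}, k @: Group gN = Group gN}.
  move=> k /unit_permsP[u Uu kE]; apply/eqP; rewrite eqEcard card_imset ?leqnn ?andbT //.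
    by apply/subsetP => _ /imsetP[x Nx ->]; rewrite kE; apply: unN.
  exact: perm_inj.
by case: (A_prim sub inv) => /(congr1 val) /=; [left | right].
Qed.

Lemma sring_rank2 :
  (forall x y, x != 0 -> y != 0 -> basic_set x = basic_set y) -> sring_rank A = 2.
Proof.
move=> same; rewrite /sring_rank.
have -> : basic_sets A = [set basic_set 0; basic_set 1].
  apply/setP => X; rewrite !inE; apply/idP/orP => [SX|[]/eqP->]; try exact: basic_setP.
  have /set0Pn[x Xx] : X != set0.
    by apply: contraTneq SX => ->; have /and3P[] := sring_partition A.
  move: Xx; rewrite -def_basic_set // => /eqP <-.
  by have [->|x0] := eqVneq x 0; [left | right; rewrite (same x 1) ?oner_neq0].
rewrite cards2; case: eqP => // /esym/basic_set_eq0/eqP.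
by rewrite oner_eq0.
Qed.

(** As each nonzero x is a unit, its class is x times the class of 1, hence the orbit of x under
    K. *)
Lemma field_cyclotomic : (forall x : R, x != 0 -> x \is a GRing.unit) -> cyclotomic A.
Proof.
move=> fieldR; pose K := [set k in unit_perms R | basic_set (k 1) == basic_set 1].
have KP (k : {perm R}) :
    reflect (exists u, [/\ u \is a GRing.unit, basic_set u = basic_set 1
                         & forall x, k x = u * x]) (k \in K).
  rewrite inE; apply: (iffP andP) => [[/unit_permsP[u Uu kE]]|[u [Uu cu kE]]].
    by rewrite kE mulr1 => /eqP cu; exists u.
  by split; [apply/unit_permsP; exists u | rewrite kE mulr1 cu].
have gK : group_set K.
  apply/group_setP; split=> [|k l].
    by apply/KP; exists 1; split=> [||x]; rewrite ?unitr1 // perm1 mul1r.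
  move=> /KP[u [Uu cu kE]] /KP[v [Uv cv lE]]; apply/KP; exists (v * u).
  split=> [||x]; rewrite ?unitrM ?Uv // ?permM ?lE ?kE ?mulrA //.
  by rewrite (basic_set_unit Uv cu) mulr1.
exists (Group gK); first by apply/subsetP => k; rewrite inE => /andP[].
move=> a; split=> [/sring_elemsP a_const k /KP[u [Uu cu kE]]|a_fix].
  apply/ffunP => z; rewrite -{1}(permKV k z) gring_act_eval; apply: a_const.
  rewrite -{2}(permKV k z) kE mulrC -[in LHS](mulr1 (_ z)).
  have [->|w0] := eqVneq ((k^-1)%g z) 0; first by rewrite !mul0r.
  by apply: basic_set_unit; rewrite ?cu ?fieldR.
apply/sring_elemsP => x y cxy.
have [x0|x0] := eqVneq x 0; first by rewrite (basic_set_eq0 (x := y)) ?x0 // -cxy x0.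
have Ux := fieldR x x0.
have y0 : y != 0 by apply: contraNneq x0 => y0; apply/eqP/basic_set_eq0; rewrite cxy y0.
have Uu : y / x \is a GRing.unit by rewrite unitrM fieldR // unitrV.
pose k : {perm R} := perm (mulrI Uu).
have Kk : k \in K.
  apply/KP; exists (y / x); split=> [//||z]; last by rewrite permE.
  by rewrite -[in RHS](mulVr Ux) mulrC; apply: basic_set_unit; rewrite ?unitrV.
by rewrite -{2}(a_fix k Kk) -(gring_act_eval k a x) permE divrK.
Qed.

(** The ideal x R is stable under all units, so its sum is fixed by K and lies in A. By primitivity
    x R is R, and x is invertible. *)
Lemma cyclotomic_field : cyclotomic A -> GRing.field_axiom R.
Proof.
case=> K /subsetP sK AK x x0.
pose N := [set x * y | y : R].
have NP z : reflect (exists y, z = x * y) (z \in N).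
  by apply: (iffP imsetP) => [[y _ ->]|[y ->]]; exists y.
have unN : unit_stable N by move=> u _ _ /NP[y ->]; apply/NP; exists (u * y); ring.
have satN : saturated basic_set N.
  have /AK/sring_elemsP h : {in K, forall k, gring_act k (gsum N) = gsum N}.
    move=> k /sK /unit_permsP[u Uu kE]; apply/ffunP => z.
    rewrite -(permKV k z) gring_act_eval !ffunE kE; congr (nat_of_bool _)%:R.
    apply/idP/idP => [|H]; first exact: unN.
    by rewrite -(mulKr Uu (_ z)); apply: unN; rewrite ?unitrV.
  by move=> y z /h; rewrite !ffunE; case: (y \in N); case: (z \in N).
case: (quasiprimitive_class_primitive _ _ unN satN) => [||N1|NT].
- by apply/NP; exists 0; rewrite mulr0.
- by move=> _ _ /NP[y ->] /NP[z ->]; apply/NP; exists (y + z); rewrite mulrDr.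
- have : x \in N by apply/NP; exists 1; rewrite mulr1.
  by rewrite N1 inE (negPf x0).
- have : 1 \in N by rewrite NT inE.
  by case/NP => y xy; apply/unitrPr; exists y.
Qed.

End SchurRing.

(** * Primary components and the two cases of the theorem *)

(** The normal Sylow subgroup contains every p-element, and #|P| annihilates x * y as it does x. *)
Lemma sylow_mulr (R : finComUnitRingType) p (P : {group R}) (x y : R) :
  (p.-Sylow([set: R]) P)%g -> x \in P -> x * y \in P.
Proof.
move=> sylP Px.
have nP : (P <| [set: R])%g.
  by rewrite -sub_abelian_normal ?subsetT //; apply/centsP => u _ v _; exact: addrC.
rewrite (mem_normal_Hall sylP nP) ?inE // /p_elt.
apply: pnat_dvd (pHall_pgroup sylP); rewrite order_dvdn; apply/eqP.
transitivity (x *+ #|P| * y); first exact/esym/mulrnAl.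
by rewrite (_ : x *+ #|P| = 0) ?mul0r //; exact: expg_cardG Px.
Qed.

Lemma local_ring_rank2_or_field (R : finComUnitRingType) (A : sring R) :
  sring_over_ring A -> quasiprimitive A ->
  add_closed [set x : R | x \isn't a GRing.unit] ->
  sring_rank A = 2 \/ cyclotomic A.
Proof.
move=> A_inv A_prim addM.
case: (pickP (fun h : R => (h != 0) && (h \isn't a GRing.unit))) => [h|noneR].
  case/andP=> h0 Uh; left; apply: sring_rank2 => x y.
  apply: (local_ring_classes (sring_class_map A_inv) _ addM _ h0); last by rewrite inE.
  exact: quasiprimitive_class_primitive.
right; apply: field_cyclotomic => // x x0.
by have := noneR x; rewrite x0 /= => /negbFE.
Qed.

(** [idempotent_splitting_classes] is applied to the fused classes and yields transitivity of the
    units on nonzero classes; [transitive_classes] then undoes the fusion, e being neither 0 nor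
    1. *)
Lemma nonlocal_ring_rank2 (R : finComUnitRingType) (A : sring R)
    p (P : {group R}) (e : R) :
  sring_over_ring A -> quasiprimitive A -> primary_component p P ->
  e \in P -> {in P, forall x, e * x = x} -> ideal_of P (nonunits P e) -> e != 1 ->
  sring_rank A = 2.
Proof.
move=> A_inv A_prim [p_pr p_dvd sylP] Pe eP [_ M0 addM mulM] e1.
have cP := sring_class_map A_inv.
have prim := quasiprimitive_class_primitive A_prim.
have ee : e * e = e by exact: eP.
have cardP : #|P| = (p ^ logn p #|R|)%N by rewrite (card_Hall sylP) cardsT p_part.
have eR x : e * x \in P by exact: sylow_mulr sylP Pe.
have imP : [set e * x | x : R] = P.
  apply/setP => x; apply/imsetP/idP => [[y _ ->]|Px]; first exact: eR.
  by exists x; rewrite ?eP.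
pose M := [set x | e * x \in nonunits P e].
have ME x : (x \in M) = (e * x \in nonunits P e) by rewrite inE.
have e0 : e != 0.
  apply: contraTneq p_dvd => e0.
  have : (#|P| <= 1)%N.
    rewrite -(cards1 (0 : R)); apply/subset_leq_card/subsetP => x /eP.
    by rewrite e0 mul0r inE => <-.
  rewrite cardP leqNgt -[X in (X < _)%N](expn0 p) ltn_exp2l ?prime_gt1 // logn_gt0.
  rewrite mem_primes p_pr /= negb_and => /orP[/negP[]|//].
  by apply/card_gt0P; exists 0.
apply: sring_rank2 => x y.
apply: (transitive_classes cP ee e0 e1); move=> {}x {}y.
apply: (@idempotent_splitting_classes _ _ _ (unit_classes_map cP)
  (unit_classes_primitive cP prim) _ p (logn p #|R|) (#|R|`_p^')%N e M) => //.
- by move=> u z; exact: (unit_classes_stable cP).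
- by rewrite -p'natE // part_pnat.
- by rewrite -cardP; exact: expg_cardG Pe.
- by rewrite imP.
- by rewrite -p_part partnC //; apply/card_gt0P; exists 0.
- by rewrite ME mulr0.
- by move=> a b; rewrite !ME mulrDr; exact: addM.
- move=> a b; rewrite !ME => Mb; have -> : e * (a * b) = (e * a) * (e * b).
    by rewrite mulrACA ee.
  exact: mulM.
- rewrite ME ee inE Pe negb_and negbK orFb; apply/exists_inP; by exists e; rewrite ?ee.
- by rewrite ME mulrBr mulr1 ee subrr.
- move=> a; rewrite ME inE eR /= negbK => /exists_inP[b _ /eqP eab].
  by exists b.
Qed.

Theorem theorem1p1 (R : finComUnitRingType) (A : sring R) :
  (forall (p : nat) (P : {group R}), primary_component p P -> local_subring P) ->
  sring_over_ring A -> quasiprimitive A ->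
  (sring_rank A = 2 \/ cyclotomic A) /\ (cyclotomic A -> GRing.field_axiom R).
Proof.
move=> local A_inv A_prim; split; last exact: cyclotomic_field.
have cardR : (1 < #|R|)%N.
  by rewrite (cardD1 0) (cardD1 1) !inE oner_neq0.
have [P sylP] := Sylow_exists (pdiv #|R|) [set: R].
have compP : primary_component (pdiv #|R|) P.
  by split; rewrite ?pdiv_prime ?pdiv_dvd.
have [e [Pe eP idealM]] := local _ _ compP.
(* If e = 1, the ideal P is all of R, and R itself is local. *)
have [e1|e1] := eqVneq e 1; last first.
  by left; exact: nonlocal_ring_rank2 compP Pe eP idealM e1.
apply: local_ring_rank2_or_field => //.
have PT x : x \in P by rewrite -(mul1r x) -e1; exact: sylow_mulr sylP Pe.
have [_ _ addM _] := idealM.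
have E x : (x \in nonunits P e) = (x \isn't a GRing.unit).
  rewrite inE PT /=; congr (~~ _); apply/exists_inP/unitrPr => [[y _ /eqP xy]|[y xy]].
    by exists y; rewrite -e1.
  by exists y; rewrite ?PT // e1 xy.
by move=> x y; rewrite !inE -!E; exact: addM.
Qed.
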